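(* Let $G$ be a group, let $S$ be a finite primitive right $G$-set, let $F$ be an arbitrary field, and let $v \in F[S]$. Write $t = |\mathrm{supp}(v)|$, $d = \dim_F(\langle v\rangle)$ and $n = |S|$. If $1 \le t < n$, then $$(t+1)\,d \ge 2n.$$
   Context: For a field $F$ and a right $G$-set $S$, $F[S]$ denotes the permutation module: the $F$-vector space of (finite) formal $F$-linear combinations of elements of $S$, with the right action of $G$ on $S$ extended linearly to $F[S]$. For $v\in F[S]$, $\mathrm{supp}(v)$ is the set of points of $S$ that occur with nonzero coefficient in $v$, and $\langle v\rangle$ is the $G$-submodule of $F[S]$ generated by $v$, i.e. the $F$-linear span of the translates $vg$, $g\in G$. A nonempty subset $\Delta\subseteq S$ of a transitive $G$-set is a block if for every $g\in G$ either $\Delta g=\Delta$ or $\Delta g\cap\Delta=\emptyset$; the trivial blocks are $S$ and the one-point subsets. A transitive (nonempty) $G$-set is primitive if every block is trivial. *)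

(* Defs.v *)
From HB Require Import structures.
From mathcomp Require Import all_boot all_order all_algebra.
From mathcomp Require Import boolp.
Set Implicit Arguments.
Unset Strict Implicit.
Unset Printing Implicit Defensive.
Import GRing.Theory.
Local Open Scope ring_scope.

(* The group G is a [groupType], hence not assumed finite. *)
Record right_action (G : groupType) (S : Type) := RightAction {
  act :> S -> G -> S;
  act1 : forall s : S, act s 1%g = s;
  actM : forall (s : S) (g h : G), act s (g * h)%g = act (act s g) h }.

Section GSet.
Variables (G : groupType) (S : finType) (to : right_action G S).

Definition set_translate (D : {set S}) (g : G) : {set S} :=
  [set to s g | s in D].

Definition is_block (D : {set S}) : Prop :=
  D <> set0 /\
  forall g : G,
    set_translate D g = D \/ set_translate D g :&: D = set0.

Definition trivial_block (D : {set S}) : Prop :=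
  D = [set: S] \/ exists s : S, D = [set s].

Definition transitive_gset : Prop :=
  (0 < #|S|)%N /\
  forall x y : S, exists g : G, to x g = y.

Definition primitive_gset : Prop :=
  transitive_gset /\ forall D : {set S}, is_block D -> trivial_block D.

End GSet.

(* As S is finite, formal linear combinations are all functions S -> F;
   [F^o] is F viewed as a vector space over itself. *)
Notation permmod F S := {ffun S -> F^o}.

Section PermutationModule.
Variables (F : fieldType) (G : groupType) (S : finType).
Variable to : right_action G S.
Implicit Types v w : permmod F S.

Definition pm_point (s : S) : permmod F S := [ffun x => (x == s)%:R].

Definition pm_act v (g : G) : permmod F S :=
  \sum_(s : S) v s *: pm_point (to s g).

Definition supp v : {set S} := [set s | v s != 0].

Definition in_translate_span v w : Prop :=
  exists r : seq (F * G), w = \sum_(x <- r) x.1 *: pm_act v x.2.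

(* G may be infinite, but it induces only finitely many self-maps of S. *)
Lemma translate_span_exists v :
  exists U : {vspace permmod F S},
    forall w, w \in U <-> in_translate_span v w.
Proof.
pose T (f : {ffun S -> S}) : permmod F S := \sum_(s : S) v s *: pm_point (f s).
pose P (f : {ffun S -> S}) := `[< exists g : G, T f = pm_act v g >].
exists (\sum_(f : {ffun S -> S} | P f) <[T f]>)%VS => w; split.
  case/memv_sumP => u uP ->.
  elim/big_ind: _ => [|x y [r ->] [r' ->]|f Pf].
  - by exists [::]; rewrite big_nil.
  - by exists (r ++ r'); rewrite big_cat.
  - have /vlineP[k ->] := uP f Pf.
    have [g ->] := asboolP _ Pf.
    by exists [:: (k, g)]; rewrite big_seq1.
case=> r ->; rewrite big_seq; apply: memv_suml => -[k g] _ /=.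
apply: memvZ.
have Tg : T [ffun s => to s g] = pm_act v g.
  by apply: eq_bigr => s _; rewrite ffunE.
have Pg : P [ffun s => to s g] by apply/asboolP; exists g.
rewrite -Tg; exact: subvP (sumv_sup _ Pg (subvv _)) _ (memv_line _).
Qed.

(* The F-linear span of the translates of v; the choice is unique, as its
   members are prescribed (see [gen_submodP]). *)
Definition gen_submod v : {vspace permmod F S} :=
  sval (cid (translate_span_exists v)).

Lemma gen_submodP v w : w \in gen_submod v <-> in_translate_span v w.
Proof. exact: (svalP (cid (translate_span_exists v))). Qed.

End PermutationModule.

(* Main.v *)
(** Write [U] for the submodule generated by [v]. Proportionality of the
    coordinate functionals [w |-> w s] on [U] is a [G]-invariant equivalence
    relation on [S], so by primitivity it is either total or equality. It is
    not total, for then all points would lie in the support of [v]. Now take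
    a basis of [U] made of [d] translates of [v] and consider the [d * n]
    matrix of their coordinates: every column is nonzero, and since distinct
    columns are not proportional, at most [d] of them have a single nonzero
    entry. Counting nonzero entries by rows and by columns gives
    [t * d >= 2 * n - d]. *)
Require Import Defs.
From HB Require Import structures.
From mathcomp Require Import all_boot all_order all_algebra.
From mathcomp Require Import boolp.
Set Implicit Arguments.
Unset Strict Implicit.
Unset Printing Implicit Defensive.
Import GRing.Theory.
Local Open Scope ring_scope.

Section Blocks.
Variables (G : groupType) (S : finType) (to : right_action G S).

Lemma actK (g : G) : cancel (to^~ g) (to^~ g^-1%g).
Proof. by move=> s; rewrite -actM mulgV act1. Qed.

Lemma actKV (g : G) : cancel (to^~ g^-1%g) (to^~ g).
Proof. by move=> s; rewrite -actM mulVg act1. Qed.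

(** Each equivalence class is a block, since translation permutes the classes. If [R] relates two
    distinct points, their class is no singleton, so it is all of [S]. *)
Lemma primitive_invariant_equiv (R : S -> S -> Prop) :
    (forall x, R x x) -> (forall x y, R x y -> R y x) ->
    (forall x y z, R x y -> R y z -> R x z) ->
    (forall x y g, R x y -> R (to x g) (to y g)) ->
  primitive_gset to ->
  (forall x y, R x y) \/ (forall x y, R x y -> x = y).
Proof.
move=> Rxx Rsym Rtrans Ract [_ prim].
case: (pselect (forall x y, R x y -> x = y)) => [|nRd]; first by right.
left; have [a [b [Rab nab]]] : exists a b, R a b /\ a <> b.
  apply: contrapT => nex; apply: nRd => x y Rxy.
  by apply: contrapT => nxy; apply: nex; exists x, y.
pose D := [set x | `[< R a x >]].
have inD x : reflect (R a x) (x \in D) by rewrite inE; apply: asboolP.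
have transD g x : reflect (R (to a g) x) (x \in set_translate to D g).
  apply: (iffP imsetP) => [[y /inD Ray ->]|Rx]; first exact: Ract.
  exists (to x g^-1%g); last by rewrite actKV.
  by apply/inD; have := Ract _ _ g^-1%g Rx; rewrite actK.
have blockD : is_block to D.
  split=> [D0|g]; first by have /inD := Rxx a; rewrite D0 inE.
  case: (set_0Vmem (set_translate to D g :&: D)) => [|[x]]; first by right.
  case/setIP=> /transD Rgx /inD Rax; left; apply/setP => y.
  apply/transD/inD => Ry; last exact: Rtrans Rgx (Rtrans _ _ _ (Rsym _ _ Rax) Ry).
  exact: Rtrans Rax (Rtrans _ _ _ (Rsym _ _ Rgx) Ry).
case: (prim D blockD) => [DT x y|[s Ds]].
  have RaT z : R a z by apply/inD; rewrite DT inE.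
  exact: Rtrans (Rsym _ _ (RaT x)) (RaT y).
have /inD := Rxx a; have /inD := Rab; rewrite Ds !inE => /eqP bs /eqP as_.
by case: nab; rewrite as_ bs.
Qed.

End Blocks.

Section Translates.
Variables (F : fieldType) (G : groupType) (S : finType).
Variables (to : right_action G S) (v : permmod F S).

Lemma pm_actE (g : G) (s : S) : pm_act to v g s = v (to s g^-1%g).
Proof.
rewrite /pm_act sum_ffunE (bigD1 (to s g^-1%g)) //= !ffunE actKV eqxx.
rewrite big1 => [|x xNs]; first by rewrite addr0 /GRing.scale /= mulr1.
rewrite !ffunE; case: eqP => [sE|_]; last exact: mulr0.
by rewrite sE actK eqxx in xNs.
Qed.

Lemma card_supp_pm_act (g : G) : #|supp (pm_act to v g)| = #|supp v|.
Proof.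
rewrite -[RHS](card_imset _ (can_inj (actK to g))); apply: eq_card => s.
rewrite inE pm_actE; apply/idP/imsetP => [vs|[x + ->]].
  by exists (to s g^-1%g); rewrite ?inE ?actKV.
by rewrite inE actK.
Qed.

Lemma pm_act_gen_submod (g : G) : pm_act to v g \in gen_submod to v.
Proof. by apply/gen_submodP; exists [:: (1, g)]; rewrite big_seq1 scale1r. Qed.

Lemma gen_submod_sub (U : {vspace permmod F S}) :
  (forall g, pm_act to v g \in U) -> (gen_submod to v <= U)%VS.
Proof.
move=> vU; apply/subvP => w /gen_submodP[r ->].
by apply: memv_suml => x _; apply: memvZ.
Qed.

(** Greedy extension: as long as a free family of translates has fewer than [\dim U] members, some
    translate lies outside its span, for otherwise the span would contain [U]. *)
Lemma translate_basis :
  exists2 X : seq (permmod F S), basis_of (gen_submod to v) X &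
    forall w, w \in X -> exists g, w = pm_act to v g.
Proof.
set U := gen_submod to v.
suff: forall k, (k <= \dim U)%N -> exists X : seq (permmod F S),
    [/\ free X, size X = k & forall w, w \in X -> exists g, w = pm_act to v g].
  case/(_ _ (leqnn _)) => X [frX szX trX]; exists X => //.
  rewrite basisEfree frX szX leqnn andbT; apply/span_subvP => w /trX[g ->].
  exact: pm_act_gen_submod.
elim=> [_|k IHk ltkU]; first by exists [::]; split; rewrite // nil_free.
have [X [frX szX trX]] := IHk (ltnW ltkU).
have [g gNX] : exists g, pm_act to v g \notin <<X>>%VS.
  apply: contrapT => nex; move: ltkU; rewrite ltnNge -szX => /negP; apply.
  apply: leq_trans (dim_span X); apply/dimvS/gen_submod_sub => g.
  by apply: contrapT => /negP gNX; apply: nex; exists g.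
exists (pm_act to v g :: X); split=> [||w]; rewrite ?free_cons ?gNX //= ?szX //.
by rewrite inE => /orP[/eqP ->|/trX //]; exists g.
Qed.

(** Proportionality is tested on the translates only, which suffices because they span the
    submodule. *)
Definition prop_coord (s s' : S) : Prop :=
  exists2 c : F, c != 0 & forall g, pm_act to v g s = c * pm_act to v g s'.

Lemma prop_coord_trivial :
    primitive_gset to -> (1 <= #|supp v|)%N -> (#|supp v| < #|S|)%N ->
  forall s s', prop_coord s s' -> s = s'.
Proof.
move=> prim /card_gt0P[a]; rewrite inE => va ltvS.
have [] := @primitive_invariant_equiv _ _ to prop_coord _ _ _ _ prim => //.
- by move=> s; exists 1 => [|g]; rewrite ?oner_eq0 ?mul1r.
- move=> s s' [c c0 ss']; exists c^-1 => [|g]; first by rewrite invr_eq0.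
  by rewrite ss' mulKf.
- move=> x y z [c c0 xy] [c' c'0 yz]; exists (c * c') => [|g].
    by rewrite mulf_neq0.
  by rewrite xy yz mulrA.
(* The translate by [h] takes at [to x g] the value that the translate by [h * g^-1] takes at
   [x]. *)
- move=> x y g [c c0 xy]; exists c => // h; have := xy (h * g^-1)%g.
  by rewrite !pm_actE invgM invgK !actM.
move=> total; suff: supp v = [set: S] by move=> vT; rewrite vT cardsT ltnn in ltvS.
apply/setP => s; rewrite !inE; have [c c0 /(_ 1%g)] := total s a.
by rewrite !pm_actE invg1 !act1 => ->; rewrite mulf_neq0.
Qed.

End Translates.

(** Carries relations between columns of the coordinate matrix over to the whole span. The case
    [c = 0] handles a zero column. *)
Lemma span_coord_eq (F : fieldType) (S : finType) (X : seq (permmod F S))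
    (s s' : S) (c : F) (w : permmod F S) :
  (forall i : 'I_(size X), X`_i s = c * X`_i s') -> w \in <<X>>%VS ->
  w s = c * w s'.
Proof.
move=> Xc /(@coord_span _ _ _ (in_tuple X)) ->; rewrite !sum_ffunE mulr_sumr.
apply: eq_bigr => i _; rewrite !ffunE /GRing.scale /= Xc.
by rewrite mulrCA.
Qed.

Theorem theoremC (G : groupType) (S : finType) (to : right_action G S)
    (F : fieldType) (v : permmod F S) :
  primitive_gset to ->
  (1 <= #|supp v|)%N ->
  (#|supp v| < #|S|)%N ->
  (2 * #|S| <= (#|supp v| + 1) * \dim (gen_submod to v))%N.
Proof.
move=> prim v_gt0 ltvS; have propE := prop_coord_trivial prim v_gt0 ltvS.
have [X basX trX] := translate_basis to v.
have spanX g : pm_act to v g \in <<X>>%VS.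
  by rewrite (span_basis basX) pm_act_gen_submod.
rewrite (size_basis (X := in_tuple X) basX).
pose C s := [set i : 'I_(size X) | X`_i s != 0].
have C_gt0 s : (0 < #|C s|)%N.
  rewrite lt0n cards_eq0; apply/eqP => C0.
  have [a] := card_gt0P v_gt0; rewrite inE => /eqP; apply.
  (* The translate by a [g] that moves [a] to [s] has value [v a] at [s], yet a zero column at [s]
     forces every translate to vanish there. *)
  have [g ag] := prim.1.2 a s; rewrite -(actK to g a) ag -pm_actE.
  rewrite (@span_coord_eq _ _ X s s 0 _ _ (spanX g)) ?mul0r // => i.
  by rewrite mul0r; have := in_set0 i; rewrite -C0 inE => /negbFE/eqP.
pose D := [set s | #|C s| == 1%N].
have leDX : (#|D| <= size X)%N.
  have injC : {in D &, injective C}.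
    (* Two columns whose only nonzero entry is in the same row [i] are proportional, with ratio read
       off in that row. *)
    move=> s s'; rewrite !inE => /cards1P[i Ci] _ Css'; apply: propE.
    have Xi (j : 'I_(size X)) : (X`_j s != 0) = (j == i) by have := in_set1 j i; rewrite -Ci inE.
    have Xi' (j : 'I_(size X)) : (X`_j s' != 0) = (j == i).
      by have := in_set1 j i; rewrite -Ci Css' inE.
    have [Xis Xis'] : X`_i s != 0 /\ X`_i s' != 0 by rewrite Xi Xi'.
    exists (X`_i s / X`_i s') => [|g]; first by rewrite mulf_neq0 ?invr_eq0.
    apply: span_coord_eq (spanX g) => j.
    have [->|jNi] := eqVneq j i; first by rewrite divfK.
    have /negbFE/eqP -> : (X`_j s != 0) = false by rewrite Xi (negbTE jNi).
    have /negbFE/eqP -> : (X`_j s' != 0) = false by rewrite Xi' (negbTE jNi).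
    by rewrite mulr0.
  rewrite -(card_in_imset injC) -[leqRHS]card_ord.
  rewrite -[leqRHS](card_imset _ (@set1_inj 'I_(size X))).
  apply/subset_leq_card/subsetP => _ /imsetP[s + ->].
  by rewrite inE => /cards1P[i ->]; apply: imset_f.
have count : (\sum_s #|C s| = #|supp v| * size X)%N.
  transitivity (\sum_(i < size X) #|supp (X`_i)%R|)%N.
    under eq_bigr do rewrite -sum1dep_card big_mkcond.
    rewrite exchange_big; apply: eq_bigr => i _.
    by rewrite -sum1dep_card -big_mkcond.
  rewrite (eq_bigr (fun=> #|supp v|)) ?sum_nat_const ?card_ord 1?mulnC // => i _.
  by have [g ->] := trX _ (mem_nth 0 (ltn_ord i)); rewrite card_supp_pm_act.
rewrite mulnDl mul1n -count; apply: leq_trans (leq_add (leqnn _) leDX).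
(* With [#|D|] written as a sum of indicators, the bound holds point by point: a column has at least
   two nonzero entries, or it has exactly one and [D] supplies the missing unit. *)
rewrite -sum1dep_card [X in (_ + X)%N]big_mkcond -big_split /= mulnC.
rewrite -sum_nat_const; apply: leq_sum => s _.
by have := C_gt0 s; case: #|C s| => [|[|k]].
Qed.
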